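(* Suppose $f\in G^+$ with $\gamma(f)=(q_1,\dots,q_l)$, and $g\in Z$. Then $$\gamma(\rho\circ R_G(f))=T_G(\gamma(f)),\qquad \gamma(R_G^2(f))=T_G^2(\gamma(f)),\qquad \beta(R_Z(g))=T_Z(\beta(g)),$$ $$\mu(R_G(f))=R_Z(\mu(f)),\qquad \mu(R_G^2(f))=R_Z^{\,q_2}(\mu(f)),$$ where an exponent on an operator denotes iteration.
   Context: A form $(A,B,C)$ means $Ax^2+Bxy+Cy^2$ with $A,B,C\in\mathbb{Z}$; its discriminant is $\Delta=B^2-4AC$. All forms are indefinite: $\Delta$ is positive and not a square. A form is G-reduced if $AC<0$ and $B>|A+C|$, and Z-reduced if $A,B,C>0$ and $B>A+C$. $G$ and $Z$ are the sets of G-reduced and Z-reduced forms; $G^+=\{(A,B,C)\in G: A>0\}$. $S_1$ is the set of nonempty finite sequences of positive integers, $S_2\subset S_1$ those of length $\ge2$. Fundamental solution: for a positive nonsquare discriminant $\Delta$, the fundamental solution of $|t^2-\Delta u^2|=4$ is the solution $(t,u)$ in positive integers with $u$ minimal (for $\Delta=5$, where $(1,1)$ and $(3,1)$ both have $u=1$, it is $(1,1)$). Map $\gamma\colon G^+\to S_1$: for $f=(A,B,C)\in G^+$ with discriminant $\Delta$ and fundamental solution $(t,u)$, set $z=\frac{t+Bu}{2}$ (an integer) and let $\gamma(f)$ be the sequence of partial quotients of the finite regular continued fraction expansion (positive integer partial quotients) of $\frac{z}{Au}$ whose length is odd if $t^2-\Delta u^2=-4$ and even otherwise. Map $\beta\colon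 Z\to S_2$: for $f=(A,B,C)\in Z$ with discriminant $\Delta$ and fundamental solution $(t,u)$, set $z=\frac{t+Bu}{2}$ (an integer) and let $\beta(f)$ be the sequence of partial quotients of the finite regular continued fraction expansion of $\frac{z}{z-Au}$ whose length is even if $t^2-\Delta u^2=-4$ and odd otherwise. (Its length is always at least $2$.) Gauss reduction operator $R_G\colon G\to G$: for $f=(A,B,C)\in G$ let $\delta$ be the integer with $|\delta|=\left\lfloor\frac{B+\sqrt\Delta}{2|A|}\right\rfloor$ and $\delta A>0$; then $R_G(f)=f(\delta x+y,-x)$. Zagier reduction operator $R_Z\colon Z\to Z$: for $f=(A,B,C)\in Z$ let $n=\left\lceil\frac{B+\sqrt\Delta}{2A}\right\rceil$; then $R_Z(f)=f(nx+y,-x)$. Other maps: $\rho\colon G\to G$ with $\rho((A,B,C))=(-A,B,-C)$; $\mu\colon G\to Z$ with $\mu((A,B,C))=(A,2A+B,A+B+C)$ if $A>0$ and $\mu((A,B,C))=(A+B+C,B+2C,C)$ if $C>0$; $T_G\colon S_1\to S_1$ with $T_G((q_1,\dots,q_l))=(q_2,\dots,q_l,q_1)$; and $T_Z\colon S_2\to S_2$ with $$T_Z((q_1,\dots,q_l))=\begin{cases}(q_1-1,q_2,\dots,q_{l-1},q_l+1)&\text{if }q_1\ge2,\\(q_2,q_1)&\text{if }q_1=1,\ l=2,\\(q_3,\dots,q_l,q_2,q_1)&\text{if }q_1=1,\ l>2.\end{cases}$$ *)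

(* Defs.v *)
From Stdlib Require Export ZArith Reals Zfloor List Arith.
From Stdlib Require Import ClassicalEpsilon.
Export ListNotations.

Open Scope Z_scope.

Record form : Type := Form { fa : Z; fb : Z; fc : Z }.

Definition feval (f : form) (x y : Z) : Z :=
  fa f * x ^ 2 + fb f * x * y + fc f * y ^ 2.

Definition disc (f : form) : Z := fb f ^ 2 - 4 * fa f * fc f.

Definition indefinite (f : form) : Prop :=
  0 < disc f /\ ~ (exists n : Z, disc f = n ^ 2).

Definition G_reduced (f : form) : Prop :=
  indefinite f /\ fa f * fc f < 0 /\ fb f > Z.abs (fa f + fc f).

Definition Z_reduced (f : form) : Prop :=
  indefinite f /\ (fa f > 0 /\ fb f > 0 /\ fc f > 0) /\ fb f > fa f + fc f.

Definition G_plus (f : form) : Prop := G_reduced f /\ fa f > 0.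

(* The form f(a x + b y, c x + d y). *)
Definition fsubst (f : form) (a b c d : Z) : form :=
  Form (fa f * a ^ 2 + fb f * a * c + fc f * c ^ 2)
       (2 * fa f * a * b + fb f * (a * d + b * c) + 2 * fc f * c * d)
       (fa f * b ^ 2 + fb f * b * d + fc f * d ^ 2).

Lemma feval_fsubst (f : form) (a b c d x y : Z) :
  feval (fsubst f a b c d) x y = feval f (a * x + b * y) (c * x + d * y).
Proof. unfold feval, fsubst; cbn [fa fb fc]; ring. Qed.

(* The operators below are total functions on forms; they are only meaningful
   on the domains G_reduced (R_G, rho, mu), Z_reduced (R_Z, beta) and
   G_plus (gamma). *)

Definition R_G (f : form) : form :=
  let delta := Z.sgn (fa f) *
    Zfloor ((IZR (fb f) + sqrt (IZR (disc f))) / (2 * IZR (Z.abs (fa f))))%R in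
  fsubst f delta 1 (-1) 0.

Definition R_Z (f : form) : form :=
  let n := Zceil ((IZR (fb f) + sqrt (IZR (disc f))) / (2 * IZR (fa f)))%R in
  fsubst f n 1 (-1) 0.

Definition rho (f : form) : form := Form (- fa f) (fb f) (- fc f).

(* On G_reduced forms fa f and fc f have opposite signs, so that the second
   branch is the case fc f > 0. *)
Definition mu (f : form) : form :=
  if 0 <? fa f
  then Form (fa f) (2 * fa f + fb f) (fa f + fb f + fc f)
  else Form (fa f + fb f + fc f) (fb f + 2 * fc f) (fc f).

Definition pell_solution (D t u : Z) : Prop :=
  0 < t /\ 0 < u /\ Z.abs (t ^ 2 - D * u ^ 2) = 4.

(* D = 5 is the only discriminant for which minimality of u does not determine
   t: both (1, 1) and (3, 1) are solutions. *)
Definition is_fundamental (D t u : Z) : Prop :=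
  pell_solution D t u /\
  (forall t' u' : Z, pell_solution D t' u' -> u <= u') /\
  (D = 5 -> t = 1).

Definition fundamental_solution (D : Z) : Z * Z :=
  epsilon (inhabits (0, 0)) (fun tu => is_fundamental D (fst tu) (snd tu)).

(* Value of the finite continued fraction q_1 + 1 / (q_2 + 1 / ...). *)
Fixpoint cf_value (q : list nat) : R :=
  match q with
  | [] => 0%R
  | [a] => INR a
  | a :: r => (INR a + / cf_value r)%R
  end.

Definition regular_cf (q : list nat) (x : R) : Prop :=
  q <> [] /\ Forall (fun a => (0 < a)%nat) q /\ cf_value q = x.

Definition gamma (f : form) : list nat :=
  let '(t, u) := fundamental_solution (disc f) in
  let z := (t + fb f * u) / 2 in
  epsilon (inhabits []) (fun q =>
    regular_cf q (IZR z / IZR (fa f * u))%R /\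
    (Nat.Odd (length q) <-> t ^ 2 - disc f * u ^ 2 = -4)).

Definition beta (f : form) : list nat :=
  let '(t, u) := fundamental_solution (disc f) in
  let z := (t + fb f * u) / 2 in
  epsilon (inhabits []) (fun q =>
    regular_cf q (IZR z / IZR (z - fa f * u))%R /\
    (Nat.Even (length q) <-> t ^ 2 - disc f * u ^ 2 = -4)).

Definition T_G (q : list nat) : list nat :=
  match q with
  | [] => []
  | a :: r => r ++ [a]
  end.

(* Only meaningful on sequences of positive integers of length at least 2. *)
Definition T_Z (q : list nat) : list nat :=
  match q with
  | a :: b :: r =>
      if (2 <=? a)%nat
      then (a - 1)%nat :: removelast (b :: r) ++ [(last (b :: r) 0 + 1)%nat]
      else match r with
           | [] => [b; a]
           | _ => r ++ [b; a]
           end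
  | _ => q
  end.

(* The entry q_i for i >= 1, with indices read cyclically modulo the length:
   for a sequence of length 1, q_2 denotes q_1. *)
Definition cyclic_entry (q : list nat) (i : nat) : nat :=
  nth ((i - 1) mod length q) q 0%nat.

(* Main.v *)
Require Import Defs.
From Stdlib Require Import ClassicalEpsilon Lia Lra FinFun.

(** A continued fraction [q1; ...; ql] is encoded by the integer matrix
    M(q), the product of the matrices (q_i, 1; 1, 0): its first column gives
    the value, its determinant (-1)^l the parity of the length.  Conversely an
    integer matrix (p, m; r, s) of determinant 1 or -1 with
    1 <= r <= p, 0 <= s <= r and 1 <= m <= p is M(q) for some q, by the
    Euclidean algorithm ([cfmat_exists]).

    Let (t, u) be the solution of |t^2 - D u^2| = 4 and z = (t + B u) / 2.
    Multiplication by the unit e = (t + u sqrt D) / 2 acts on the column (w, 1),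
    w = (B + sqrt D) / (2A) being the larger root of f(x, -1), as the matrix
    (z, -C u; A u, z - B u), whose determinant is the norm of e.  For f in G+
    this matrix meets the inequalities above, so it is M(q) for a sequence q
    which must be [gamma f], since value and parity of the length determine a
    regular continued fraction ([regular_cf_unique]).  In the same way
    [beta f] is the sequence whose matrix is
    (z, z - C u; z - A u, (B - A - C) u).

    A reduction step substitutes (n x + y, -x) in f, so that it conjugates the
    first matrix by (n, 1; 1, 0), up to the signs absorbed by [rho].  If n is
    the first entry q1, this conjugation moves the factor of q1 from the left
    end of the product to the right end, which is [T_G].  That n is the
    integer prescribed by [R_G] can be read off the new matrix: it is a product
    of the same type, so its lower left entry is positive and its first row
    sum exceeds the second, which says that f(q1, -1) < 0 < f(q1 + 1, -1), that
    is q1 < w < q1 + 1 ([gauss_rotation]).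
    For [R_Z] and [T_Z] the argument is the same: the outer
    factors of the product change according to whether n = 2 (then q1 >= 2)
    or n = q2 + 2 (then q1 = 1), and the inequalities between the new
    entries give n - 1 < w < n, as D is not a square ([cfmat_T_Z], [R_Z_of_zagier_mat]).

    The two statements on [mu] follow from the position of w alone.  After
    the first step, which [mu] carries to a step of [R_Z], the larger root
    on the Zagier side stays between 1 and 2 for q2 - 1 steps, and these q2 - 1
    substitutions (2 x + y, -x) amount, through [mu], to one step of [R_G]
    ([mu_R_Z_iter], [mu_R_G_iter]).

    The maps [gamma] and [beta] are defined by choice, so a solution of
    the Pell equation must exist.  It comes from the periodicity of a walk on
    the forms a x^2 + 2 b x y - c y^2 with a, c > 0 and b^2 + a c = D, which
    are finite in number ([river_periodic], [pell_exists]).  The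
    solution depends on the discriminant only, and so
    is the same for a form and its reductions. *)

(** * Continued fractions and matrices *)

Record mat : Type := Mat { m11 : Z; m12 : Z; m21 : Z; m22 : Z }.

Definition mmul (X Y : mat) : mat :=
  Mat (m11 X * m11 Y + m12 X * m21 Y) (m11 X * m12 Y + m12 X * m22 Y)
      (m21 X * m11 Y + m22 X * m21 Y) (m21 X * m12 Y + m22 X * m22 Y).

Definition mdet (X : mat) : Z := m11 X * m22 X - m12 X * m21 X.

Fixpoint cfmat (q : list nat) : mat :=
  match q with
  | [] => Mat 1 0 0 1
  | a :: r => mmul (Mat (Z.of_nat a) 1 1 0) (cfmat r)
  end.

Definition positive (q : list nat) : Prop := Forall (fun a => (0 < a)%nat) q.

Lemma mat_ext (X Y : mat) :
  m11 X = m11 Y -> m12 X = m12 Y -> m21 X = m21 Y -> m22 X = m22 Y -> X = Y.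
Proof. destruct X, Y; simpl; congruence. Qed.

Lemma mat_entries (X Y : mat) :
  X = Y -> m11 X = m11 Y /\ m12 X = m12 Y /\ m21 X = m21 Y /\ m22 X = m22 Y.
Proof. now intros ->. Qed.

Lemma cfmat_app (q r : list nat) : cfmat (q ++ r) = mmul (cfmat q) (cfmat r).
Proof.
  induction q as [|a q IH]; cbn [app cfmat].
  - apply mat_ext; unfold mmul; cbn -[cfmat Z.mul Z.add]; ring.
  - rewrite IH. apply mat_ext; unfold mmul; cbn -[cfmat Z.mul Z.add]; ring.
Qed.

Lemma mdet_cfmat (q : list nat) :
  (Nat.Odd (length q) -> mdet (cfmat q) = -1) /\
  (Nat.Even (length q) -> mdet (cfmat q) = 1).
Proof.
  induction q as [|a q [IHo IHe]]; simpl length.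
  - split; [intros [k H]; lia | reflexivity].
  - assert (E : mdet (cfmat (a :: q)) = - mdet (cfmat q))
      by (unfold mdet; cbn [cfmat]; unfold mmul; cbn -[cfmat Z.mul Z.add]; ring).
    rewrite E, Nat.Odd_succ, Nat.Even_succ.
    split; intros H; [rewrite IHe | rewrite IHo]; easy.
Qed.

Lemma odd_length_iff (q : list nat) :
  Nat.Odd (length q) <-> mdet (cfmat q) = -1.
Proof.
  destruct (mdet_cfmat q) as [Ho He].
  destruct (Nat.Even_or_Odd (length q)) as [H|H]; split; intros H'; auto.
  rewrite (He H) in H'. discriminate.
Qed.

Lemma even_length_iff (q : list nat) :
  Nat.Even (length q) <-> mdet (cfmat q) = 1.
Proof.
  destruct (mdet_cfmat q) as [Ho He].
  destruct (Nat.Even_or_Odd (length q)) as [H|H]; split; intros H'; auto.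
  rewrite (Ho H) in H'. discriminate.
Qed.

(** The last inequality compares the two row sums. It is what
    places the larger root below [q1 + 1] in [gauss_rotation]. *)
Lemma cfmat_entries (q : list nat) :
  q <> [] -> positive q ->
  let X := cfmat q in
  1 <= m21 X <= m11 X /\ 0 <= m22 X <= m12 X /\ 1 <= m12 X /\
  m21 X + m22 X < m11 X + m12 X.
Proof.
  intros Hn Hp; cbv zeta; induction Hp as [|a q Ha Hq IH]; [easy|].
  destruct q as [|b q].
  - simpl. lia.
  - specialize (IH ltac:(discriminate)).
    change (cfmat (a :: b :: q))
      with (mmul (Mat (Z.of_nat a) 1 1 0) (cfmat (b :: q))).
    destruct (cfmat (b :: q)) as [p m r s]; unfold mmul; cbn -[Z.mul Z.add Z.of_nat] in *.
    assert (p <= Z.of_nat a * p) by nia. assert (m <= Z.of_nat a * m) by nia.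
    lia.
Qed.

Lemma cfmat_m22_pos (a : nat) (q : list nat) :
  q <> [] -> positive q -> 1 <= m22 (cfmat (a :: q)).
Proof.
  intros Hn Hp. pose proof (cfmat_entries q Hn Hp) as H; cbv zeta in H.
  cbn [cfmat]. unfold mmul; cbn -[cfmat Z.mul Z.add]. lia.
Qed.

Lemma cf_value_cons (a : nat) (q : list nat) :
  q <> [] -> cf_value (a :: q) = (INR a + / cf_value q)%R.
Proof. now destruct q. Qed.

Lemma cf_value_cfmat (q : list nat) :
  q <> [] -> positive q ->
  cf_value q = (IZR (m11 (cfmat q)) / IZR (m21 (cfmat q)))%R.
Proof.
  intros Hn Hp; induction Hp as [|a q Ha Hq IH]; [easy|].
  destruct (list_eq_dec Nat.eq_dec q []) as [->|Hq0].
  - simpl. rewrite INR_IZR_INZ, Z.mul_1_r, Z.add_0_r. field.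
  - rewrite cf_value_cons, IH by assumption.
    pose proof (cfmat_entries q Hq0 Hq) as H; cbv zeta in H.
    cbn [cfmat]. unfold mmul; cbn -[cfmat IZR Z.mul Z.add].
    rewrite INR_IZR_INZ.
    replace (1 * m11 (cfmat q) + 0 * m21 (cfmat q)) with (m11 (cfmat q)) by ring.
    rewrite plus_IZR, !mult_IZR.
    field. split; apply not_0_IZR; lia.
Qed.

Lemma cf_value_ge1 (q : list nat) :
  q <> [] -> positive q -> (1 <= cf_value q)%R /\ (cf_value q = 1%R -> q = [1%nat]).
Proof.
  intros Hn Hp; induction Hp as [|a q Ha Hq IH]; [easy|].
  assert (Ha' : (1 <= INR a)%R) by (apply (le_INR 1); lia).
  destruct (list_eq_dec Nat.eq_dec q []) as [->|Hq0].
  - split; [exact Ha'|].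
    intros H. f_equal. apply INR_eq. exact H.
  - rewrite cf_value_cons by assumption.
    destruct (IH Hq0) as [H1 _].
    pose proof (Rinv_0_lt_compat (cf_value q) ltac:(lra)).
    split; [|intros]; lra.
Qed.

Lemma cf_digit_unique (a b : nat) (v w : R) :
  (1 <= v)%R -> (1 <= w)%R -> (INR a + / v = INR b + / w)%R -> a = b.
Proof.
  intros Hv Hw H.
  pose proof (Rinv_0_lt_compat v ltac:(lra)).
  pose proof (Rinv_0_lt_compat w ltac:(lra)).
  pose proof (Rinv_le_contravar 1 v ltac:(lra) Hv).
  pose proof (Rinv_le_contravar 1 w ltac:(lra) Hw).
  rewrite Rinv_1 in *.
  assert (INR a < INR (b + 1))%R by (rewrite plus_INR; simpl; lra).
  assert (INR b < INR (a + 1))%R by (rewrite plus_INR; simpl; lra).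
  apply INR_lt in H4, H5. lia.
Qed.

(** The only coincidence between a short and a long expansion is
    [a + 1] = [a; 1], which changes the parity of the length. *)
Lemma cf_value_singleton (a b : nat) (q : list nat) :
  q <> [] -> positive q -> INR a = cf_value (b :: q) -> q = [1%nat].
Proof.
  intros Hn Hp H. rewrite cf_value_cons in H by assumption.
  destruct (cf_value_ge1 q Hn Hp) as [H1 H2].
  apply H2.
  pose proof (Rinv_0_lt_compat (cf_value q) ltac:(lra)).
  pose proof (Rinv_le_contravar 1 (cf_value q) ltac:(lra) H1).
  rewrite Rinv_1 in *.
  assert (INR b < INR a)%R by lra.
  apply INR_lt in H4.
  assert (INR (b + 1) <= INR a)%R by (apply le_INR; lia).
  rewrite plus_INR in H5; simpl in H5.
  rewrite <- (Rinv_inv (cf_value q)). replace (/ cf_value q)%R with 1%R by lra.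
  apply Rinv_1.
Qed.

(** Two tails have values at least 1, so the first entries agree and the
    tails have the same value. The case of a single entry against several is
    excluded by parity. *)
Lemma regular_cf_unique (q r : list nat) (x : R) :
  regular_cf q x -> regular_cf r x ->
  (Nat.Odd (length q) <-> Nat.Odd (length r)) -> q = r.
Proof.
  intros (Hn & Hp & Hv) (Hn' & Hp' & Hv') Hpar.
  rewrite <- Hv' in Hv. clear x Hv'.
  revert r Hn' Hp' Hv Hpar.
  induction Hp as [|a q Ha Hq IH]; [easy|].
  intros [|b r] Hn' Hp' Hv Hpar; [easy|].
  inversion Hp' as [|? ? Hb Hr]; subst.
  destruct (list_eq_dec Nat.eq_dec q []) as [->|Hq0];
    destruct (list_eq_dec Nat.eq_dec r []) as [->|Hr0].
  - f_equal. apply INR_eq. exact Hv.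
  - exfalso. apply cf_value_singleton in Hv; auto. subst r.
    destruct (proj1 Hpar) as [k Hk]; [exists 0%nat; easy | simpl in Hk; lia].
  - exfalso. symmetry in Hv. apply cf_value_singleton in Hv; auto. subst q.
    destruct (proj2 Hpar) as [k Hk]; [exists 0%nat; easy | simpl in Hk; lia].
  - rewrite !cf_value_cons in Hv by assumption.
    destruct (cf_value_ge1 q) as [Gq _]; auto.
    destruct (cf_value_ge1 r) as [Gr _]; auto.
    assert (a = b) by exact (cf_digit_unique a b _ _ Gq Gr Hv). subst b.
    f_equal. apply IH; auto.
    + rewrite <- (Rinv_inv (cf_value q)), <- (Rinv_inv (cf_value r)).
      f_equal. lra.
    + simpl length in Hpar. rewrite !Nat.Odd_succ in Hpar.
      pose proof (Nat.Even_or_Odd (length q)). pose proof (Nat.Even_or_Odd (length r)).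
      pose proof (Nat.Even_Odd_False (length q)). pose proof (Nat.Even_Odd_False (length r)).
      tauto.
Qed.

(** Euclidean algorithm on the first column; the determinant condition makes
    the bounds on the second column pass to the remainder. When [r = 1], the
    values 0 and 1 of [s] correspond to the sequences [p] and [p - 1; 1]. *)
Lemma cfmat_exists (p m r s : Z) :
  1 <= r <= p -> 0 <= s <= r -> 1 <= m <= p -> Z.abs (p * s - m * r) = 1 ->
  exists q, q <> [] /\ positive q /\ cfmat q = Mat p m r s.
Proof.
  intros Hr. assert (Hr0 : 0 <= r) by lia.
  revert p m s Hr. pattern r; apply Z_lt_induction; [clear r Hr0|exact Hr0].
  intros r IH p m s Hr Hs Hm Hd.
  destruct (Z.eq_dec r 1) as [->|Hr1].
  - destruct (Z.eq_dec s 0) as [->|Hs0].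
    + exists [Z.to_nat p]. repeat split; [easy|repeat constructor; lia|].
      apply mat_ext; simpl; lia.
    + exists [Z.to_nat (p - 1); 1%nat].
      assert (s = 1) by lia. subst s.
      repeat split; [easy|repeat constructor; lia|].
      apply mat_ext; simpl; lia.
  - pose proof (Z.div_mod p r ltac:(lia)) as Edm.
    pose proof (Z.mod_pos_bound p r ltac:(lia)) as Bm.
    set (a := p / r) in *. set (r1 := p mod r) in *. clearbody a r1.
    (* r > 1 cannot divide p, since the determinant is a unit. *)
    assert (1 <= r1).
    { destruct (Z.eq_dec r1 0) as [E|]; [|lia].
      exfalso. rewrite E in Edm.
      assert (Hdv : r * (a * s - m) = 1 \/ r * (a * s - m) = -1) by nia.
      generalize dependent (a * s - m). intros k Hk.
      destruct (Z.le_gt_cases k 0), (Z.le_gt_cases 0 k); nia. }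
    assert (1 <= a) by nia.
    assert (1 <= s) by nia.
    assert (Hd1 : Z.abs (r * (m - a * s) - s * r1) = 1).
    { replace (r * (m - a * s) - s * r1) with (- (p * s - m * r)) by nia. lia. }
    destruct (IH r1 ltac:(lia) r s (m - a * s)) as (q & Hq & Hp & E);
      [lia|nia|lia|exact Hd1|].
    exists (Z.to_nat a :: q). repeat split; [easy|constructor; [lia|exact Hp]|].
    cbn [cfmat]. rewrite E. apply mat_ext; unfold mmul; cbn -[Z.mul Z.add];
      rewrite ?Z2Nat.id by lia; nia.
Qed.

(** * Existence of the fundamental solution *)

(** One step along the boundary between positive and negative values (Conway's
    river) of the form a x^2 + 2 b x y - c y^2, encoded by (a, b, c): [e] is
    the value at (1, 1), and replaces whichever end of the basis has its sign. *)
Definition river_step (s : Z * Z * Z) : Z * Z * Z :=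
  let '(a, b, c) := s in
  let e := a + 2 * b - c in
  if 0 <? e then (e, b - c, c) else (a, a + b, - e).

Definition on_river (D : Z) (s : Z * Z * Z) : Prop :=
  let '(a, b, c) := s in 0 < a /\ 0 < c /\ b ^ 2 + a * c = D.

Lemma river_step_on (D : Z) (s : Z * Z * Z) :
  ~ (exists n, D = n ^ 2) -> on_river D s -> on_river D (river_step s).
Proof.
  intros HD. destruct s as [[a b] c]; cbn [river_step on_river].
  intros (Ha & Hc & E).
  destruct (Z.ltb_spec 0 (a + 2 * b - c)); cbn [on_river].
  - repeat split; [lia|lia|rewrite <- E; ring].
  - repeat split; [lia| |rewrite <- E; ring].
    destruct (Z.eq_dec (a + 2 * b - c) 0) as [E0|]; [|lia].
    (* A zero value would make the form isotropic, that is D a square. *)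
    exfalso. apply HD. exists (a + b).
    replace c with (a + 2 * b) in E by lia. rewrite <- E. ring.
Qed.

(** The sign of [a' - 2 b' - c'] at the image tells which of the two
    moves was made. *)
Lemma river_step_inj (D : Z) (s s' : Z * Z * Z) :
  on_river D s -> on_river D s' -> river_step s = river_step s' -> s = s'.
Proof.
  destruct s as [[a b] c], s' as [[a' b'] c']; cbn [river_step on_river].
  intros (Ha & Hc & E) (Ha' & Hc' & E').
  destruct (Z.ltb_spec 0 (a + 2 * b - c)), (Z.ltb_spec 0 (a' + 2 * b' - c'));
    rewrite !pair_equal_spec; intros [[H1 H2] H3]; lia.
Qed.

Definition river (D : Z) (n : nat) : Z * Z * Z := Nat.iter n river_step (1, 0, D).

Lemma river_on (D : Z) (n : nat) :
  0 < D -> ~ (exists n, D = n ^ 2) -> on_river D (river D n).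
Proof.
  intros H0 HD. induction n as [|n IH]; [repeat split; [exact H0|ring]|].
  now apply river_step_on.
Qed.

(** The walk carries a basis (x, y), (v, w) in which x^2 - D y^2 takes the
    current shape. A step adds one vector to the other, so the coordinates
    grow; this shows below that a return to the start gives a unit other than 1. *)
Lemma river_vectors (D : Z) (n : nat) :
  let '(a, b, c) := river D n in
  exists x y v w,
    0 < x /\ 0 <= y /\ 0 <= v /\ 0 < w /\ Z.of_nat n + 2 <= x + y + v + w /\
    x ^ 2 - D * y ^ 2 = a /\ x * v - D * y * w = b /\ v ^ 2 - D * w ^ 2 = - c.
Proof.
  induction n as [|n IH].
  - exists 1, 0, 0, 1. lia.
  - change (river D (S n)) with (river_step (river D n)).
    destruct (river D n) as [[a b] c]; cbn [river_step].
    destruct IH as (x & y & v & w & Hx & Hy & Hv & Hw & Hs & Ea & Eb & Ec).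
    destruct (0 <? a + 2 * b - c).
    + exists (x + v), (y + w), v, w. repeat split; nia.
    + exists x, y, (x + v), (y + w). repeat split; nia.
Qed.

Lemma river_cancel (D : Z) (i k : nat) :
  0 < D -> ~ (exists n, D = n ^ 2) ->
  river D (i + k) = river D i -> river D k = river D 0.
Proof.
  intros H0 HD. induction i as [|i IH]; [easy|].
  intros H. apply IH.
  apply (river_step_inj D); [now apply river_on|now apply river_on|exact H].
Qed.

(** An injective map on a finite set is periodic at its starting point. *)
Lemma river_periodic (D : Z) :
  0 < D -> ~ (exists n, D = n ^ 2) ->
  exists n, (0 < n)%nat /\ river D n = (1, 0, D).
Proof.
  intros H0 HD.
  destruct (excluded_middle_informative
    (exists n, (0 < n)%nat /\ river D n = (1, 0, D))) as [H|H]; [exact H|exfalso].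
  assert (Hlt : forall i j, (i < j)%nat -> river D i <> river D j).
  { intros i j Hij E. apply H. exists (j - i)%nat. split; [lia|].
    apply (river_cancel D i (j - i)); auto.
    rewrite E. f_equal. lia. }
  assert (Inj : Injective (river D)).
  { intros i j E. destruct (Nat.lt_trichotomy i j) as [L|[L|L]]; auto; exfalso.
    - exact (Hlt _ _ L E).
    - exact (Hlt _ _ L (eq_sym E)). }
  (* All coefficients met on the walk lie between -D and D. *)
  pose (R := map (fun k => Z.of_nat k - D) (seq 0 (Z.to_nat (2 * D + 1)))).
  assert (HR : forall z, - D <= z <= D -> In z R).
  { intros z Hz. apply in_map_iff. exists (Z.to_nat (z + D)).
    split; [lia|]. apply in_seq. lia. }
  pose (L := list_prod (list_prod R R) R).
  assert (Hlen : (length (map (river D) (seq 0 (S (length L)))) <= length L)%nat).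
  { apply NoDup_incl_length.
    - apply Injective_map_NoDup; [exact Inj|apply seq_NoDup].
    - intros s Hs. apply in_map_iff in Hs as (i & <- & _).
      pose proof (river_on D i H0 HD) as Ho.
      destruct (river D i) as [[a b] c]. destruct Ho as (Ha & Hc & E).
      apply in_prod; [apply in_prod|]; apply HR; nia. }
  rewrite length_map, length_seq in Hlen. lia.
Qed.

Lemma pell_exists (D : Z) :
  0 < D -> ~ (exists n, D = n ^ 2) ->
  exists x y, 0 < x /\ 0 < y /\ x ^ 2 - D * y ^ 2 = 1.
Proof.
  intros H0 HD. destruct (river_periodic D H0 HD) as (n & Hn & E).
  pose proof (river_vectors D n) as V. rewrite E in V.
  destruct V as (x & y & v & w & Hx & Hy & Hv & Hw & Hs & Ea & Eb & Ec).
  exists x, y. repeat split; auto.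
  (* If y = 0 the basis is the initial one, against the growth of its entries. *)
  destruct (Z.eq_dec y 0) as [->|]; [exfalso|lia].
  assert (x = 1) by nia. subst x.
  assert (v = 0) by lia. subst v.
  assert (w = 1) by nia. lia.
Qed.

Lemma is_fundamental_exists (D : Z) :
  0 < D -> ~ (exists n, D = n ^ 2) -> exists t u, is_fundamental D t u.
Proof.
  intros H0 HD.
  destruct (Z.eq_dec D 5) as [->|H5].
  { exists 1, 1. repeat split; try lia. intros t u (_ & Hu & _). lia. }
  destruct (pell_exists D H0 HD) as (x & y & Hx & Hy & E).
  assert (P : exists t, pell_solution D t (2 * y)).
  { exists (2 * x). split; [lia|split; [lia|]].
    replace ((2 * x) ^ 2 - D * (2 * y) ^ 2)
      with (4 * (x ^ 2 - D * y ^ 2)) by ring. lia. }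
  assert (Hu : 0 <= 2 * y) by lia.
  revert P. pattern (2 * y); apply Z_lt_induction; [|exact Hu].
  clear - H5. intros u IH [t P].
  destruct (excluded_middle_informative
    (exists t' u', u' < u /\ pell_solution D t' u')) as [(t' & u' & L & P')|N].
  - apply (IH u'); [destruct P' as (_ & ? & _); lia|now exists t'].
  - exists t, u. repeat split; try apply P; [|easy].
    intros t' u' P'. destruct (Z.le_gt_cases u u') as [|L]; [easy|].
    exfalso. apply N. now exists t', u'.
Qed.

Lemma fundamental_solution_pell (f : form) :
  indefinite f ->
  pell_solution (disc f) (fst (fundamental_solution (disc f)))
                         (snd (fundamental_solution (disc f))).
Proof.
  intros [H0 HD]. unfold fundamental_solution.
  match goal with |- context [epsilon ?i ?P] =>
    assert (S : P (epsilon i P)) end.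
  { apply epsilon_spec.
    destruct (is_fundamental_exists (disc f) H0 HD) as (t & u & F).
    now exists (t, u). }
  apply S.
Qed.

(** * Forms, units and their matrices *)

(** Here [z] stands for (t + B u) / 2, and [z - B u] is (t - B u) / 2: the
    matrix by which multiplication by (t + u sqrt D) / 2 acts on the column
    with entries (B + sqrt D) / 2 and A. *)
Definition gauss_mat (f : form) (u z : Z) : mat :=
  Mat z (- fc f * u) (fa f * u) (z - fb f * u).

(** The product (1, 0; 1, -1) [gauss_mat f u z] (1, 1; 0, 1). The left factor
    turns the value [z / (A u)] into [z / (z - A u)] and reverses the
    determinant, hence the parity in the definition of [beta]; the right factor
    makes the second column positive. *)
Definition zagier_mat (f : form) (u z : Z) : mat :=
  Mat z (z - fc f * u) (z - fa f * u) ((fb f - fa f - fc f) * u).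

(** [t] and [B u] have the same parity, as t^2 - B^2 u^2 is even. *)
Lemma pell_half (f : form) (t u : Z) :
  pell_solution (disc f) t u -> exists z, 2 * z = t + fb f * u.
Proof.
  intros (Ht & Hu & E).
  assert (H4 : exists k, t ^ 2 - disc f * u ^ 2 = 4 * k)
    by (destruct (Z.abs_eq_or_opp (t ^ 2 - disc f * u ^ 2)); [exists 1|exists (-1)]; lia).
  destruct H4 as [k Hk]. unfold disc in Hk.
  assert (Hs : Z.even ((t + fb f * u) * (t - fb f * u)) = true).
  { replace ((t + fb f * u) * (t - fb f * u))
      with (2 * (2 * (k - fa f * fc f * u ^ 2))) by nia.
    now rewrite Z.even_mul. }
  rewrite Z.even_mul, Z.even_add, Z.even_sub, Bool.orb_diag in Hs.
  rewrite <- Z.even_add in Hs. apply Z.even_spec in Hs.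
  destruct Hs as [z Hz]. now exists z.
Qed.

Lemma pell_det (f : form) (t u z : Z) :
  2 * z = t + fb f * u ->
  t ^ 2 - disc f * u ^ 2 = 4 * mdet (gauss_mat f u z).
Proof.
  intros Hz. unfold disc, mdet, gauss_mat; cbn [m11 m12 m21 m22].
  replace t with (2 * z - fb f * u) by lia. ring.
Qed.

Lemma half_eq (w z : Z) : 2 * z = w -> w / 2 = z.
Proof. intros <-. rewrite Z.mul_comm. apply Z.div_mul. lia. Qed.

(** The computation of [gamma] comes down to exhibiting one matrix product:
    its first column has the prescribed value and its determinant the
    prescribed parity. *)
Lemma gamma_of_cfmat (f : form) (q : list nat) (t u z : Z) :
  fundamental_solution (disc f) = (t, u) ->
  2 * z = t + fb f * u ->
  q <> [] -> positive q -> cfmat q = gauss_mat f u z -> gamma f = q.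
Proof.
  intros EF Hz Hn Hp E.
  pose proof (pell_det f t u z Hz) as Ed.
  unfold gamma. rewrite EF, (half_eq _ z Hz).
  match goal with |- epsilon ?i ?P = _ =>
    assert (HQ : P q); [|pose proof (epsilon_spec i P (ex_intro _ q HQ)) as HS] end.
  - split.
    + repeat split; auto. rewrite cf_value_cfmat, E by assumption. reflexivity.
    + rewrite odd_length_iff, E. lia.
  - destruct HS as [H1 H2], HQ as [H3 H4].
    apply (regular_cf_unique _ _ _ H1 H3). tauto.
Qed.

Lemma beta_of_cfmat (f : form) (q : list nat) (t u z : Z) :
  fundamental_solution (disc f) = (t, u) ->
  2 * z = t + fb f * u ->
  q <> [] -> positive q -> cfmat q = zagier_mat f u z -> beta f = q.
Proof.
  intros EF Hz Hn Hp E.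
  pose proof (pell_det f t u z Hz) as Ed.
  unfold beta. rewrite EF, (half_eq _ z Hz).
  match goal with |- epsilon ?i ?P = _ =>
    assert (HQ : P q); [|pose proof (epsilon_spec i P (ex_intro _ q HQ)) as HS] end.
  - split.
    + repeat split; auto. rewrite cf_value_cfmat, E by assumption. reflexivity.
    + rewrite even_length_iff, E, Ed.
      assert (mdet (zagier_mat f u z) = - mdet (gauss_mat f u z))
        by (unfold mdet, zagier_mat, gauss_mat; cbn [m11 m12 m21 m22]; ring).
      lia.
  - destruct HS as [H1 H2], HQ as [H3 H4].
    apply (regular_cf_unique _ _ _ H1 H3).
    pose proof (Nat.Even_or_Odd (length q)).
    match goal with |- Nat.Odd (length ?l) <-> _ =>
      pose proof (Nat.Even_or_Odd (length l)); pose proof (Nat.Even_Odd_False (length l)) end.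
    pose proof (Nat.Even_Odd_False (length q)).
    tauto.
Qed.

(** Write r = A u, m = - C u, b = B u. The determinant condition says that
    z^2 - b z - m r is 1 or -1, and G-reducedness gives b > |r - m|. If one of
    r <= z, m <= z and z - b <= r failed, this number would exceed 1 in absolute
    value, by the factorizations below. *)
Lemma cfmat_gauss_exists (f : form) (u z : Z) :
  G_plus f -> 0 < u -> 0 < z -> Z.abs (mdet (gauss_mat f u z)) = 1 ->
  exists q, q <> [] /\ positive q /\ cfmat q = gauss_mat f u z.
Proof.
  intros [(_ & HAC & HB) HA] Hu Hz Hd. unfold gauss_mat, mdet in *.
  cbn [m11 m12 m21 m22] in Hd.
  assert (Hr : 0 < fa f * u) by nia.
  assert (Hm : 0 < - fc f * u) by nia.
  assert (Hb : fa f * u - (- fc f * u) + 1 <= fb f * u) by nia.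
  assert (Hb' : - fc f * u - fa f * u + 1 <= fb f * u) by nia.
  generalize dependent (fa f * u). intros r.
  generalize dependent (- fc f * u). intros m.
  generalize dependent (fb f * u). intros b. intros.
  assert (r <= z).
  { destruct (Z.le_gt_cases r z) as [|L]; [easy|exfalso].
    assert ((r - z) * (z + m) >= 1) by nia.
    assert (z * (z - b) - m * r <= - ((r - z) * (z + m)) - z) by nia. lia. }
  assert (m <= z).
  { destruct (Z.le_gt_cases m z) as [|L]; [easy|exfalso].
    assert ((m - z) * (z + r) >= 1) by nia.
    assert (z * (z - b) - m * r <= - ((m - z) * (z + r)) - z) by nia. lia. }
  assert (0 <= z - b) by nia.
  assert (z - b <= r).
  { destruct (Z.le_gt_cases (z - b) r) as [|L]; [easy|exfalso].
    assert (((z - b) - r) * ((z - b) + m) >= 1) by nia.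
    assert (z * (z - b) - m * r >= ((z - b) - r) * ((z - b) + m) + (z - b)) by nia.
    lia. }
  apply cfmat_exists; lia.
Qed.

(** Write r = A u, m = C u, b = B u and y = b - z, so that y^2 - b y + m r is
    1 or -1 with b > r + m, and y is the smaller solution. The inequalities to
    be shown reduce to y <= m and y <= r, and
    these hold because if y exceeds just one of m and r then
    y^2 - b y + m r <= (y - r)(y - m) - y < -1, and if it exceeds both then
    (b - y) y > m r + 1. *)
Lemma cfmat_zagier_exists (f : form) (u z : Z) :
  Z_reduced f -> 0 < u -> fb f * u < 2 * z ->
  Z.abs (mdet (gauss_mat f u z)) = 1 ->
  exists q, q <> [] /\ positive q /\ cfmat q = zagier_mat f u z.
Proof.
  intros (_ & (HA & HB & HC) & HABC) Hu Hz Hd. unfold gauss_mat, zagier_mat, mdet in *.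
  cbn [m11 m12 m21 m22] in Hd.
  replace ((fb f - fa f - fc f) * u) with (fb f * u - fa f * u - fc f * u) by ring.
  assert (Hr : 0 < fa f * u) by nia.
  assert (Hm : 0 < fc f * u) by nia.
  assert (Hb : fa f * u + fc f * u + 1 <= fb f * u) by nia.
  replace (- fc f * u) with (- (fc f * u)) in Hd by ring.
  generalize dependent (fa f * u). intros r.
  generalize dependent (fc f * u). intros m.
  generalize dependent (fb f * u). intros b. intros.
  assert (Ey : exists y, y = b - z) by (now exists (b - z)). destruct Ey as [y Ey].
  assert (z = b - y) by lia. subst z.
  replace (b - y - b) with (- y) in Hd by ring.
  assert (Hy : y <= m /\ y <= r).
  { destruct (Z.le_gt_cases y m), (Z.le_gt_cases y r); [lia|exfalso|exfalso|exfalso].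
    - assert (y * y - b * y + m * r <= - ((y - r) * (m - y)) - y) by nia. nia.
    - assert (y * y - b * y + m * r <= - ((r - y) * (y - m)) - y) by nia. nia.
    - assert ((b - y) * y >= (y + 1) * y) by nia.
      assert ((y + 1) * y >= (m + 2) * (r + 1)) by nia. nia. }
  apply cfmat_exists; [lia|lia|lia|].
  rewrite <- Hd, <- Z.abs_opp. f_equal. ring.
Qed.

(** * Reading the reduction steps off the matrices *)

(** Compare (2 A n - B)^2 with D: their difference is 4 A f(n). *)
Lemma root_gt (A B C D n : Z) :
  0 < A -> D = B ^ 2 - 4 * A * C -> A * n ^ 2 - B * n + C < 0 ->
  (IZR n < (IZR B + sqrt (IZR D)) / (2 * IZR A))%R.
Proof.
  intros HA HD Hn.
  assert (HA' : (0 < IZR A)%R) by (now apply IZR_lt).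
  apply Rmult_lt_reg_r with (2 * IZR A)%R; [lra|].
  replace ((IZR B + sqrt (IZR D)) / (2 * IZR A) * (2 * IZR A))%R
    with (IZR B + sqrt (IZR D))%R by (field; lra).
  assert (Hs : (IZR (2 * A * n - B) < sqrt (IZR D))%R).
  { destruct (Z.lt_ge_cases (2 * A * n - B) 0) as [L|L].
    - apply Rlt_le_trans with 0%R; [now apply IZR_lt|apply sqrt_pos].
    - rewrite <- (sqrt_square (IZR (2 * A * n - B))) by (now apply IZR_le).
      rewrite <- mult_IZR. apply sqrt_lt_1_alt. split; [apply IZR_le; nia|].
      apply IZR_lt. nia. }
  rewrite minus_IZR, !mult_IZR in Hs. lra.
Qed.

(** The point [k] lies between the roots, so [n > k] with a positive value is
    beyond the larger one. *)
Lemma root_lt (A B C D k n : Z) :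
  0 < A -> D = B ^ 2 - 4 * A * C ->
  k < n -> A * k ^ 2 - B * k + C < 0 -> 0 < A * n ^ 2 - B * n + C ->
  ((IZR B + sqrt (IZR D)) / (2 * IZR A) < IZR n)%R.
Proof.
  intros HA HD Hkn Hk Hn.
  assert (HA' : (0 < IZR A)%R) by (now apply IZR_lt).
  apply Rmult_lt_reg_r with (2 * IZR A)%R; [lra|].
  replace ((IZR B + sqrt (IZR D)) / (2 * IZR A) * (2 * IZR A))%R
    with (IZR B + sqrt (IZR D))%R by (field; lra).
  assert (L : 0 < 2 * A * n - B).
  { assert ((n - k) * (A * (n + k) - B) > 0) by nia.
    assert (A * (n + k) - B > 0) by nia. nia. }
  assert (Hs : (sqrt (IZR D) < IZR (2 * A * n - B))%R).
  { rewrite <- (sqrt_square (IZR (2 * A * n - B))) by (apply IZR_le; lia).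
    rewrite <- mult_IZR.
    assert (0 < A * (A * n ^ 2 - B * n + C)) by nia.
    assert (D < (2 * A * n - B) * (2 * A * n - B)) by lia.
    assert (A * (A * k ^ 2 - B * k + C) < 0) by nia.
    assert (0 <= (2 * A * k - B) * (2 * A * k - B)) by apply Z.square_nonneg.
    assert (0 <= D) by lia.
    apply sqrt_lt_1_alt. split; [apply IZR_le|apply IZR_lt]; lia. }
  rewrite minus_IZR, !mult_IZR in Hs. lra.
Qed.

(** The larger root of f(x, -1) lies strictly between [n] and [n + 1]
    (see [larger_root_bounds]): an integral form of the floor and ceiling
    conditions in [R_G] and [R_Z]. *)
Definition larger_root_in (f : form) (n : Z) : Prop :=
  0 < fa f /\ feval f n (-1) < 0 /\ 0 < feval f (n + 1) (-1).

Lemma larger_root_bounds (f : form) (n : Z) :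
  larger_root_in f n ->
  (IZR n < (IZR (fb f) + sqrt (IZR (disc f))) / (2 * IZR (fa f)) < IZR n + 1)%R.
Proof.
  unfold feval, larger_root_in; intros (HA & H1 & H2). split.
  - apply root_gt with (C := fc f); [exact HA|reflexivity|unfold feval in *; lia].
  - rewrite <- plus_IZR.
    apply root_lt with (C := fc f) (k := n);
      [exact HA|reflexivity|lia|unfold feval in *; lia|unfold feval in *; lia].
Qed.

Lemma R_G_eq (f : form) (n : Z) :
  larger_root_in f n -> R_G f = fsubst f n 1 (-1) 0.
Proof.
  intros H. pose proof (larger_root_bounds f n H) as Hb. destruct H as [HA _].
  unfold R_G. rewrite Z.abs_eq, Z.sgn_pos by lia.
  rewrite (Zfloor_eq n) by lra. now rewrite Z.mul_1_l.
Qed.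

Lemma R_Z_eq (f : form) (n : Z) :
  larger_root_in f n -> R_Z f = fsubst f (n + 1) 1 (-1) 0.
Proof.
  intros H. pose proof (larger_root_bounds f n H) as Hb.
  unfold R_Z. rewrite (Zceil_eq (n + 1)); [reflexivity|].
  rewrite plus_IZR. lra.
Qed.

Lemma form_ext (f g : form) :
  fa f = fa g -> fb f = fb g -> fc f = fc g -> f = g.
Proof. destruct f, g; simpl; congruence. Qed.

Lemma rho_rho (f : form) : rho (rho f) = f.
Proof. apply form_ext; cbn -[Z.opp]; lia. Qed.

Lemma disc_rho (f : form) : disc (rho f) = disc f.
Proof. unfold disc, rho; cbn [fa fb fc]; ring. Qed.

Lemma disc_fsubst (f : form) (n : Z) : disc (fsubst f n 1 (-1) 0) = disc f.
Proof. unfold disc, fsubst; cbn [fa fb fc]; ring. Qed.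

(** This allows two steps of [R_G] to be written as two steps of
    the composite of [R_G] with [rho], which stays on forms with A > 0. *)
Lemma R_G_rho (f : form) : R_G (rho f) = rho (R_G f).
Proof.
  unfold R_G. rewrite disc_rho.
  replace (fa (rho f)) with (- fa f) by reflexivity.
  replace (fb (rho f)) with (fb f) by reflexivity.
  rewrite Z.abs_opp, Z.sgn_opp. cbv zeta.
  generalize (Zfloor ((IZR (fb f) + sqrt (IZR (disc f))) / (2 * IZR (Z.abs (fa f))))).
  intros w. apply form_ext; unfold fsubst, rho; cbn [fa fb fc]; ring.
Qed.

(** The matrix of [r ++ [a]] is that of [a :: r] conjugated by (a, 1; 1, 0),
    hence the matrix of the form obtained from [f] with [n = a]. Its
    lower left entry is - u f(a, -1), and the difference of its row sums is
    u f(a + 1, -1); both are positive, so [a] is the integer used by [R_G]. *)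
Lemma gauss_rotation (f : form) (u z : Z) (a : nat) (r : list nat) :
  0 < u -> positive (a :: r) -> cfmat (a :: r) = gauss_mat f u z ->
  larger_root_in f (Z.of_nat a) /\ fc f < 0 /\
  cfmat (r ++ [a]) =
    gauss_mat (rho (R_G f)) u (z - fb f * u + fa f * Z.of_nat a * u).
Proof.
  intros Hu Hp E.
  pose (f1 := rho (fsubst f (Z.of_nat a) 1 (-1) 0)).
  (* [f1] is what [R_G] will turn out to give. *)
  assert (E1 : cfmat (r ++ [a]) =
    gauss_mat f1 u (z - fb f * u + fa f * Z.of_nat a * u)).
  { rewrite cfmat_app. cbn [cfmat] in *.
    destruct (cfmat r) as [p m s d]; unfold mmul, gauss_mat in *.
    apply mat_entries in E as (Ez & EC & EA & EB). cbn [m11 m12 m21 m22] in *.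
    (* Multiples of the entrywise equations that make the goals linear. *)
    pose proof (f_equal (Z.mul (Z.of_nat a)) EA) as EA1.
    pose proof (f_equal (Z.mul (Z.of_nat a)) EA1) as EA2.
    pose proof (f_equal (Z.mul (Z.of_nat a)) EB) as EB1.
    pose proof (f_equal (Z.mul (Z.of_nat a)) Ez) as Ez1.
    subst f1; unfold rho, fsubst. apply mat_ext; cbn [m11 m12 m21 m22 fa fb fc]; lia. }
  pose proof (cfmat_entries (a :: r) ltac:(discriminate) Hp) as B0; cbv zeta in B0.
  assert (Hp1 : positive (r ++ [a])).
  { inversion Hp; subst. apply Forall_app; repeat constructor; auto. }
  assert (Hn1 : r ++ [a] <> []) by (now destruct r).
  pose proof (cfmat_entries _ Hn1 Hp1) as B1; cbv zeta in B1.
  rewrite E in B0. rewrite E1 in B1.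
  unfold gauss_mat, f1, rho, fsubst in B0, B1. cbn [m11 m12 m21 m22 fa fb fc] in B0, B1.
  assert (HR : larger_root_in f (Z.of_nat a)).
  { unfold larger_root_in, feval. repeat split; nia. }
  repeat split; [apply HR|apply HR|apply HR|nia|].
  rewrite (R_G_eq f _ HR). exact E1.
Qed.

(** The lower right entry, positive for length at least 2, is - u g(n - 1, -1);
    the difference of the entries in the first column is u g(n, -1). *)
Lemma R_Z_of_zagier_mat (g : form) (u z n : Z) (q : list nat) :
  Z_reduced g -> 0 < u -> positive q -> (2 <= length q)%nat ->
  cfmat q = zagier_mat (fsubst g n 1 (-1) 0) u z ->
  R_Z g = fsubst g n 1 (-1) 0.
Proof.
  intros ([_ HD] & (HA & _) & _) Hu Hp Hl E.
  destruct q as [|a [|b q]]; [simpl in Hl; lia|simpl in Hl; lia|].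
  pose proof (cfmat_entries (a :: b :: q) ltac:(discriminate) Hp) as B; cbv zeta in B.
  pose proof (cfmat_m22_pos a (b :: q) ltac:(discriminate) (Forall_inv_tail Hp)) as B'.
  rewrite E in B, B'. unfold zagier_mat, fsubst in B, B'.
  cbn [m11 m12 m21 m22 fa fb fc] in B, B'.
  assert (Hn : feval g (n - 1) (-1) < 0) by (unfold feval; nia).
  assert (Hn' : 0 <= feval g n (-1)) by (unfold feval; nia).
  (* A zero value would make the discriminant a square. *)
  assert (Hn0 : feval g n (-1) <> 0).
  { intros E0. apply HD. exists (2 * fa g * n - fb g). unfold feval in E0.
    unfold disc. nia. }
  rewrite (R_Z_eq g (n - 1)).
  - f_equal. ring.
  - repeat split; [lia|exact Hn|]. replace (n - 1 + 1) with n by ring. lia.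
Qed.

Lemma length_T_Z (q : list nat) : (2 <= length q)%nat -> length (T_Z q) = length q.
Proof.
  destruct q as [|a [|b q]]; try (simpl; lia). intros _. cbn [T_Z].
  destruct (2 <=? a)%nat.
  - destruct (exists_last (l := b :: q) ltac:(discriminate)) as (l & e & ->).
    rewrite removelast_last. simpl. rewrite !length_app. reflexivity.
  - destruct q as [|c q]; [reflexivity|]. rewrite length_app. simpl. lia.
Qed.

Lemma T_Z_positive (q : list nat) : positive q -> positive (T_Z q).
Proof.
  destruct q as [|a [|b q]]; [easy|easy|]. intros H. cbn [T_Z].
  inversion H as [|? ? Ha H']; subst.
  destruct (Nat.leb_spec 2 a).
  - destruct (exists_last (l := b :: q) ltac:(discriminate)) as (l & e & E).
    rewrite E in *. rewrite removelast_last, last_last.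
    apply Forall_app in H' as [Hl He].
    constructor; [lia|]. apply Forall_app; split; [exact Hl|].
    repeat constructor. lia.
  - inversion H' as [|? ? Hb Hq]; subst.
    destruct q as [|c q]; [repeat constructor; auto|].
    apply Forall_app; split; [exact Hq|repeat constructor; auto].
Qed.

(** Conjugation by (n, -1; 1, 0), read through the factors of [zagier_mat],
    multiplies the product of [q] on the left and on the right. For
    [n = 2] the factors are (1, -1; 0, 1) and (1, 0; 1, 1): they decrease the
    first entry and increase the last. For [n = q2 + 2] they are the inverse of
    (1, 1; 1, 0) (q2, 1; 1, 0), which removes the first two entries, and
    (q2, 1; 1, 0) (1, 1; 1, 0), which appends them in reverse. *)
Lemma cfmat_T_Z (g : form) (u z : Z) (q : list nat) :
  positive q -> (2 <= length q)%nat -> cfmat q = zagier_mat g u z ->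
  exists n, cfmat (T_Z q) =
    zagier_mat (fsubst g n 1 (-1) 0) u (z - fb g * u + n * fa g * u).
Proof.
  intros Hp Hl E. destruct q as [|a [|b q]]; [simpl in Hl; lia|simpl in Hl; lia|].
  cbn [T_Z]. destruct (Nat.leb_spec 2 a) as [Ha|Ha].
  - exists 2.
    destruct (exists_last (l := b :: q) ltac:(discriminate)) as (l & e & El).
    rewrite El in *. rewrite removelast_last, last_last.
    cbn [cfmat] in *. rewrite cfmat_app in *. cbn [cfmat] in *.
    replace (Z.of_nat (a - 1)) with (Z.of_nat a - 1) by lia.
    replace (Z.of_nat (e + 1)) with (Z.of_nat e + 1) by lia.
    destruct (cfmat l) as [p m r s]; unfold mmul, zagier_mat, fsubst in *.
    apply mat_entries in E as (E11 & E12 & E21 & E22).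
    cbn [m11 m12 m21 m22] in *.
    apply mat_ext; cbn [m11 m12 m21 m22 fa fb fc]; lia.
  - exists (Z.of_nat b + 2).
    assert (a = 1%nat) by (inversion Hp; lia). subst a.
    replace (match q with [] => [b; 1%nat] | _ :: _ => q ++ [b; 1%nat] end)
      with (q ++ [b; 1%nat]) by now destruct q.
    rewrite cfmat_app. cbn [cfmat] in *.
    change (Z.of_nat 1) with 1 in *.
    destruct (cfmat q) as [p m r s]; unfold mmul, zagier_mat, fsubst in *.
    apply mat_entries in E as (E11 & E12 & E21 & E22).
    cbn [m11 m12 m21 m22] in *.
    generalize dependent (Z.of_nat b). intros e E11 E12 E21 E22.
    (* The new entries are polynomials of degree 2 in the second quotient e. *)
    pose proof (f_equal (Z.mul e) E11) as F11.
    pose proof (f_equal (Z.mul e) E12) as F12.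
    pose proof (f_equal (Z.mul e) E21) as F21.
    pose proof (f_equal (Z.mul e) E22) as F22.
    pose proof (f_equal (Z.mul e) F11) as G11.
    pose proof (f_equal (Z.mul e) F21) as G21.
    apply mat_ext; cbn [m11 m12 m21 m22 fa fb fc]; lia.
Qed.

(** * The map [mu] *)

(** On forms with A > 0, [mu] is the substitution (x + y, y), which moves
    the larger root w to w + 1, and the ceiling of w + 1 is [n + 2]. *)
Lemma mu_R_G (f : form) (n : Z) :
  larger_root_in f n -> mu (R_G f) = R_Z (mu f).
Proof.
  intros H. rewrite (R_G_eq f n H). destruct H as (HA & H1 & H2).
  unfold feval in H1, H2.
  assert (Hmu : mu f = Form (fa f) (2 * fa f + fb f) (fa f + fb f + fc f)).
  { unfold mu. destruct (Z.ltb_spec 0 (fa f)); [reflexivity|lia]. }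
  rewrite Hmu, (R_Z_eq _ (n + 1)).
  - unfold mu, fsubst; cbn [fa fb fc].
    destruct (Z.ltb_spec 0 (fa f * n ^ 2 + fb f * n * -1 + fc f * (-1) ^ 2)); [lia|].
    apply form_ext; cbn [fa fb fc]; ring.
  - unfold larger_root_in, feval; cbn [fa fb fc]. repeat split; lia.
Qed.

(** Each step substitutes (2 x + y, -x). The larger root of the current form
    stays between 1 and 2 because [f] is negative at (j, -1) for 0 <= j <= n,
    by convexity. *)
Lemma mu_R_Z_iter (f : form) (n k : nat) :
  larger_root_in f (Z.of_nat n) -> fc f < 0 -> (k < n)%nat ->
  Nat.iter k R_Z (mu (rho f)) =
    fsubst (rho f) (Z.of_nat k + 1) (Z.of_nat k) 1 1.
Proof.
  intros (HA & H1 & _) HC. induction k as [|k IH]; intros Hk.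
  - change (mu (rho f) = fsubst (rho f) (0 + 1) 0 1 1).
    unfold mu, rho, fsubst; cbn [fa fb fc].
    destruct (Z.ltb_spec 0 (- fa f)); [lia|].
    apply form_ext; cbn [fa fb fc]; ring.
  - assert (Hneg : forall j, 0 <= j <= Z.of_nat n -> feval f j (-1) < 0).
    { unfold feval in *. intros j Hj. set (m := Z.of_nat n) in *.
      (* f(j, -1) against its linear interpolation between 0 and m. *)
      assert (Em : m * (fa f * j ^ 2 + fb f * j * -1 + fc f * (-1) ^ 2) =
        j * (fa f * m ^ 2 + fb f * m * -1 + fc f * (-1) ^ 2) +
        (m - j) * fc f - fa f * (j * (m - j) * m)) by ring.
      assert (0 < m) by lia.
      assert (0 <= j * (m - j) * m) by nia.
      assert (0 <= fa f * (j * (m - j) * m)) by nia.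
      nia. }
    pose proof (Hneg (Z.of_nat k + 1) ltac:(lia)) as Hk1.
    pose proof (Hneg (Z.of_nat k + 2) ltac:(lia)) as Hk2.
    unfold feval in Hk1, Hk2.
    rewrite Nat.iter_succ, IH by lia. rewrite (R_Z_eq _ 1).
    + apply form_ext; unfold fsubst, rho; cbn [fa fb fc];
        rewrite ?Nat2Z.inj_succ; ring.
    + unfold larger_root_in, feval, fsubst, rho; cbn [fa fb fc].
      repeat split; lia.
Qed.

Lemma mu_R_G_iter (f : form) (n : nat) :
  larger_root_in f (Z.of_nat n) -> fc f < 0 -> (0 < n)%nat ->
  mu (R_G (rho f)) = Nat.iter (n - 1) R_Z (mu (rho f)).
Proof.
  intros H HC Hn. rewrite (mu_R_Z_iter f n) by (auto; lia).
  rewrite R_G_rho, (R_G_eq f _ H). destruct H as (_ & H1 & _). unfold feval in H1.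
  unfold mu, rho, fsubst; cbn [fa fb fc].
  match goal with |- context [0 <? ?e] => destruct (Z.ltb_spec 0 e); [|lia] end.
  replace (Z.of_nat (n - 1)) with (Z.of_nat n - 1) by lia.
  apply form_ext; cbn [fa fb fc]; ring.
Qed.

(** * The sequences [gamma] and [beta] under reduction *)

Lemma gamma_cfmat (f : form) (t u : Z) :
  G_plus f -> fundamental_solution (disc f) = (t, u) ->
  exists z, 2 * z = t + fb f * u /\ gamma f <> [] /\ positive (gamma f) /\
    cfmat (gamma f) = gauss_mat f u z.
Proof.
  intros Hf EF.
  pose proof (fundamental_solution_pell f (proj1 (proj1 Hf))) as P.
  rewrite EF in P. cbn [fst snd] in P.
  destruct (pell_half f t u P) as [z Hz].
  pose proof (pell_det f t u z Hz) as Ed.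
  destruct P as (Ht & Hu & Eabs).
  destruct (cfmat_gauss_exists f u z Hf Hu) as (q & Hn & Hp & E).
  - destruct Hf as [(_ & _ & HB) _]. assert (0 < fb f * u) by nia. lia.
  - lia.
  - exists z. rewrite (gamma_of_cfmat f q t u z EF Hz Hn Hp E). auto.
Qed.

Lemma beta_cfmat (f : form) (t u : Z) :
  Z_reduced f -> fundamental_solution (disc f) = (t, u) ->
  exists z, 2 * z = t + fb f * u /\ (2 <= length (beta f))%nat /\ positive (beta f) /\
    cfmat (beta f) = zagier_mat f u z.
Proof.
  intros Hf EF.
  pose proof (fundamental_solution_pell f (proj1 Hf)) as P.
  rewrite EF in P. cbn [fst snd] in P.
  destruct (pell_half f t u P) as [z Hz].
  pose proof (pell_det f t u z Hz) as Ed.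
  destruct P as (Ht & Hu & Eabs).
  destruct (cfmat_zagier_exists f u z Hf Hu) as (q & Hn & Hp & E); [lia|lia|].
  exists z. rewrite (beta_of_cfmat f q t u z EF Hz Hn Hp E). repeat split; auto.
  destruct Hf as (_ & _ & HB).
  destruct q as [|a [|b q]]; [easy| |simpl; lia].
  apply mat_entries in E as (_ & _ & _ & E). unfold zagier_mat in E.
  cbn [m11 m12 m21 m22 cfmat mmul] in E.
  assert (0 < (fb f - fa f - fc f) * u) by nia. lia.
Qed.

(** Gives back for [f1] all that it assumes on [f], so that it can be applied
    twice in a row. *)
Lemma gamma_rotation (f : form) (t u z : Z) (q : list nat) :
  fundamental_solution (disc f) = (t, u) -> 0 < u -> 2 * z = t + fb f * u ->
  q <> [] -> positive q -> cfmat q = gauss_mat f u z ->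
  let f1 := rho (R_G f) in
  larger_root_in f (Z.of_nat (hd 0%nat q)) /\ fc f < 0 /\ disc f1 = disc f /\
  gamma f1 = T_G q /\ T_G q <> [] /\ positive (T_G q) /\
  exists z1, 2 * z1 = t + fb f1 * u /\ cfmat (T_G q) = gauss_mat f1 u z1.
Proof.
  intros EF Hu Hz Hn Hp E f1. destruct q as [|a r]; [easy|].
  destruct (gauss_rotation f u z a r Hu Hp E) as (HR & HC & E1).
  assert (Hd : disc f1 = disc f).
  { unfold f1. rewrite disc_rho, (R_G_eq f _ HR). apply disc_fsubst. }
  assert (Hz1 : 2 * (z - fb f * u + fa f * Z.of_nat a * u) = t + fb f1 * u).
  { unfold f1. rewrite (R_G_eq f _ HR). unfold rho, fsubst; cbn [fa fb fc]. lia. }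
  assert (Hn1 : T_G (a :: r) <> []) by (now destruct r).
  assert (Hp1 : positive (T_G (a :: r))).
  { inversion Hp; subst. apply Forall_app; repeat constructor; auto. }
  repeat (split; [assumption|]).
  split; [|split; [assumption|split; [assumption|]]].
  - rewrite <- Hd in EF. exact (gamma_of_cfmat f1 _ t u _ EF Hz1 Hn1 Hp1 E1).
  - eexists; split; [exact Hz1|exact E1].
Qed.

Theorem theorem4p4 :
  forall (f g : form) (q : list nat),
    G_plus f -> gamma f = q -> Z_reduced g ->
    gamma (rho (R_G f)) = T_G (gamma f) /\
    gamma (Nat.iter 2 R_G f) = Nat.iter 2 T_G (gamma f) /\
    beta (R_Z g) = T_Z (beta g) /\
    mu (R_G f) = R_Z (mu f) /\
    mu (Nat.iter 2 R_G f) = Nat.iter (cyclic_entry q 2) R_Z (mu f).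
Proof.
  intros f g q Hf Eq Hg.
  destruct (fundamental_solution (disc f)) as [t u] eqn:EF.
  pose proof (fundamental_solution_pell f (proj1 (proj1 Hf))) as P.
  rewrite EF in P. destruct P as (_ & Hu & _). cbn [snd] in Hu.
  destruct (gamma_cfmat f t u Hf EF) as (z & Hz & Hn & Hp & E).
  rewrite Eq in *.
  destruct (gamma_rotation f t u z q EF Hu Hz Hn Hp E)
    as (HR & HC & Hd & EG & Hn1 & Hp1 & z1 & Hz1 & E1).
  set (f1 := rho (R_G f)) in *.
  rewrite <- Hd in EF.
  destruct (gamma_rotation f1 t u z1 _ EF Hu Hz1 Hn1 Hp1 E1)
    as (HR1 & HC1 & _ & EG1 & _).
  assert (EI : Nat.iter 2 R_G f = rho (R_G f1)).
  { change (R_G (R_G f) = rho (R_G f1)). unfold f1. now rewrite R_G_rho, rho_rho. }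
  assert (Emu : mu (R_G f) = R_Z (mu f)) by exact (mu_R_G f _ HR).
  split; [exact EG|]. split; [rewrite EI; exact EG1|].
  split; [|split; [exact Emu|]].
  - clear - Hg.
    destruct (fundamental_solution (disc g)) as [t u] eqn:EF.
    pose proof (fundamental_solution_pell g (proj1 Hg)) as P.
    rewrite EF in P. destruct P as (_ & Hu & _). cbn [snd] in Hu.
    destruct (beta_cfmat g t u Hg EF) as (z & Hz & Hl & Hp & E).
    destruct (cfmat_T_Z g u z (beta g) Hp Hl E) as [n En].
    pose proof (T_Z_positive _ Hp) as Hp'.
    rewrite <- (length_T_Z _ Hl) in Hl.
    pose proof (R_Z_of_zagier_mat g u _ n _ Hg Hu Hp' Hl En) as ER.
    rewrite <- (disc_fsubst g n) in EF. rewrite <- ER in *.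
    refine (beta_of_cfmat _ _ t u _ EF _ _ Hp' En).
    + rewrite ER. unfold fsubst; cbn [fb]. lia.
    + intros E0. rewrite E0 in Hl. simpl in Hl. lia.
  - assert (Ehd : cyclic_entry q 2 = hd 0%nat (T_G q)).
    { destruct q as [|a [|b r]]; [reflexivity..|].
      unfold cyclic_entry. rewrite Nat.mod_small by (simpl; lia). reflexivity. }
    assert (Hhd : (0 < hd 0 (T_G q))%nat).
    { destruct (T_G q); [easy|now inversion Hp1]. }
    rewrite Ehd.
    (* The first of the q2 Zagier steps is the image of the first step of R_G. *)
    replace (hd 0%nat (T_G q)) with (S (hd 0%nat (T_G q) - 1)) by lia.
    rewrite (Nat.iter_succ_r _ _ R_Z), <- Emu.
    replace (R_G f) with (rho f1) by apply rho_rho.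
    replace (Nat.iter 2 R_G f) with (R_G (rho f1)) by (rewrite R_G_rho; now rewrite EI).
    apply mu_R_G_iter; assumption.
Qed.
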